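(* Let $n\ge 2$ and $k\ge1$ be integers. Then $\gamma_{[k]R}(C_5\Box P_n)\le n(k+1)+2k$.
   Context: For a graph $G$ and $v\in V(G)$, $N(v)$ is the open neighborhood and $N[v]=N(v)\cup\{v\}$. For an integer $k\ge1$, a function $f:V(G)\to\{0,1,\dots,k+1\}$ is a $[k]$-Roman dominating function if for every vertex $v$ with $f(v)<k$ we have $\sum_{u\in N[v]}f(u)\ge k+|\{u\in N(v): f(u)>0\}|$. The weight of $f$ is $\sum_{v}f(v)$, and $\gamma_{[k]R}(G)$ is the minimum weight of a $[k]$-Roman dominating function on $G$. $C_m\Box P_n$ is the Cartesian product of the cycle $C_m$ (vertices $0,\dots,m-1$ mod $m$) and the path $P_n$ (vertices $0,\dots,n-1$): $(i,j)\sim(i',j')$ iff ($i=i'$ and $|j-j'|=1$) or ($j=j'$ and $i'\equiv i\pm1 \pmod m$). *)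

(* Defs.v *)
From mathcomp Require Import all_boot.

Set Implicit Arguments.
Unset Strict Implicit.
Unset Printing Implicit Defensive.

(* A finite graph is given by its adjacency relation on a finType; the facts   *)
(* that the graphs below are simple are [cycle_rel_sym], [cycle_rel_irr], etc. *)

Section Graphs.

Variables T U : finType.

Definition open_nbh (e : rel T) (v : T) : {set T} := [set u | e v u].

Definition closed_nbh (e : rel T) (v : T) : {set T} := v |: open_nbh e v.

Definition cart_prod (e : rel T) (d : rel U) : rel (T * U) :=
  fun x y => (x.1 == y.1) && d x.2 y.2 || (x.2 == y.2) && e x.1 y.1.

End Graphs.

(* The congruence i' = i - 1 is written i = i' + 1 to avoid truncated          *)
(* subtraction.                                                               *)
Definition cycle_rel (m : nat) : rel 'I_m :=
  fun i i' => (i' == i.+1 %[mod m]) || (i == i'.+1 %[mod m]).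

Definition path_rel (n : nat) : rel 'I_n :=
  fun j j' => (j' == j.+1 :> nat) || (j == j'.+1 :> nat).

Section RomanDomination.

Variables (T : finType) (e : rel T) (k : nat).

(* 'I_k.+2 is the value set {0, ..., k + 1}. *)
Definition roman_dominating (f : {ffun T -> 'I_k.+2}) : bool :=
  [forall v, (f v < k) ==>
    (k + #|[set u in open_nbh e v | 0 < f u]|
       <= \sum_(u in closed_nbh e v) f u)].

Definition weight (f : {ffun T -> 'I_k.+2}) : nat := \sum_v f v.

(* The constant function k + 1 is [k]-Roman dominating for every graph, so the *)
(* minimum is over a nonempty set; see [roman_domination_number_min].          *)
Definition roman_domination_number : nat :=
  weight [arg min_(f < [ffun=> ord_max] | roman_dominating f) weight f].

Lemma roman_dominating_max : roman_dominating [ffun=> ord_max].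
Proof. by apply/forallP => v; rewrite ffunE ltnNge leqnSn. Qed.

Lemma roman_domination_number_min :
  (exists2 f, roman_dominating f & weight f = roman_domination_number) /\
  (forall f, roman_dominating f -> roman_domination_number <= weight f).
Proof.
rewrite /roman_domination_number; case: arg_minnP => [|f Pf minf].
  exact: roman_dominating_max.
by split; [exists f | exact: minf].
Qed.

End RomanDomination.

Arguments roman_domination_number {T} e k.

Lemma cycle_rel_sym m : symmetric (@cycle_rel m).
Proof. by move=> i i'; rewrite /cycle_rel orbC. Qed.

Lemma cycle_rel_irr m : 1 < m -> irreflexive (@cycle_rel m).
Proof.
move=> m_gt1 i; rewrite /cycle_rel orbb -addn1 -{1}[val i]addn0 eqn_modDl.
by rewrite mod0n modn_small.
Qed.

Lemma path_rel_sym n : symmetric (@path_rel n).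
Proof. by move=> j j'; rewrite /path_rel orbC. Qed.

Lemma path_rel_irr n : irreflexive (@path_rel n).
Proof. by move=> j; rewrite /path_rel orbb ltn_eqF. Qed.

Lemma cart_prod_sym (T U : finType) (e : rel T) (d : rel U) :
  symmetric e -> symmetric d -> symmetric (cart_prod e d).
Proof.
move=> se sd x y.
by rewrite /cart_prod se sd (eq_sym x.1) (eq_sym x.2).
Qed.

Lemma cart_prod_irr (T U : finType) (e : rel T) (d : rel U) :
  irreflexive e -> irreflexive d -> irreflexive (cart_prod e d).
Proof. by move=> ie id x; rewrite /cart_prod ie id !andbF. Qed.

(* Main.v *)
(* Put k + 1 at (2j mod 5, j) in each column j.  Inside its own column this      *)
(* vertex dominates all but (2j + 2, j) and (2j - 2, j), which are dominated by  *)
(* the chosen vertices of the columns j + 1 and j - 1.  Only one vertex of the   *)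
(* first column and one of the last are left over; each of them gets k.         *)
Require Import Defs.
From mathcomp Require Import all_boot.
From mathcomp Require Import zify.

(** Vertices of value at least k are exempt from the condition, and a vertex of smaller value is
    satisfied by a single neighbour [u] of value k + 1: [u] pays for k and for itself, and every
    other positive neighbour contributes at least the 1 it costs. So it suffices that the slope-2
    diagonal meets the neighbourhood of every vertex of value 0, with weight k + 1 per column and k
    for each of the two vertices in [left_over]. *)

Lemma roman_dominating_nbr (T : finType) (e : rel T) (k : nat)
    (f : {ffun T -> 'I_k.+2}) :
  (forall v, f v < k -> exists2 u, e v u & f u = k.+1 :> nat) ->
  roman_dominating e f.
Proof.
move=> domf; apply/forallP => v; apply/implyP => /domf[u evu fu].
have Nu : u \in open_nbh e v by rewrite inE.
apply: (@leq_trans (\sum_(w in open_nbh e v) f w)); last first.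
  rewrite [leqRHS](bigID (mem (open_nbh e v))) /=.
  rewrite [in leqRHS](eq_bigl (mem (open_nbh e v))) ?leq_addr // => w.
  by rewrite /closed_nbh !inE; case: (e v w); rewrite ?orbT ?andbF.
have -> : #|[set w in open_nbh e v | 0 < f w]|
    = \sum_(w in open_nbh e v) (0 < f w).
  by rewrite -sum1dep_card big_mkcondr.
rewrite !(bigD1 u Nu) /= fu addnA addn1 leq_add2l.
by apply: leq_sum => w _; case: (f w : nat).
Qed.

Section Construction.

Variables n k : nat.

Definition left_over (v : 'I_5 * 'I_n.+1) : bool :=
  (v == (inord 3, ord0)) || (v == (inord (2 * n.+1 %% 5), ord_max)).

Definition diagonal_rdf : {ffun 'I_5 * 'I_n.+1 -> 'I_k.+2} :=
  [ffun v : 'I_5 * 'I_n.+1 => if v.1 == inord (2 * v.2 %% 5) then ord_max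
             else if left_over v then inord k else ord0].

Lemma diagonal_rdfE (v : 'I_5 * 'I_n.+1) :
  diagonal_rdf v = (if v.1 == 2 * v.2 %% 5 :> nat then k.+1
                    else if left_over v then k else 0) :> nat.
Proof.
rewrite ffunE -val_eqE /= inordK ?ltn_pmod //.
by do 2!case: ifP => // _; rewrite inordK.
Qed.

Lemma diagonal_rdf_dominating :
  roman_dominating (cart_prod (@cycle_rel 5) (@path_rel n.+1)) diagonal_rdf.
Proof.
apply: roman_dominating_nbr => -[i j]; rewrite diagonal_rdfE /=.
case: eqP => [_|ij]; first by rewrite ltnNge leqnSn.
case: ifP => [_|]; first by rewrite ltnn.
rewrite /left_over !xpair_eqE -!val_eqE /= !inordK ?ltn_pmod // => lo _.
have lti := ltn_ord i; have ltj := ltn_ord j.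
have nbr (u : 'I_5 * 'I_n.+1) : u.1 = 2 * u.2 %% 5 :> nat ->
    cart_prod (@cycle_rel 5) (@path_rel n.+1) (i, j) u ->
    exists2 u, cart_prod (@cycle_rel 5) (@path_rel n.+1) (i, j) u
               & diagonal_rdf u = k.+1 :> nat.
  by move=> diag adj; exists u => //; rewrite diagonal_rdfE diag eqxx.
have [up|nup] := eqVneq (i : nat) (2 * j.+1 %% 5).
  (* In the last column this vertex would be left over, which [lo] excludes. *)
  have ltSj : j.+1 < n.+1 by lia.
  apply: (nbr (i, Ordinal ltSj)) => //.
  by rewrite /cart_prod /path_rel /= !eqxx.
(* Modulo 5, 2j + 3 is 2(j - 1); for j = 0 it is the left-over row 3, so [lo] forces j > 0. *)
have [down|ndown] := eqVneq (i : nat) ((2 * j + 3) %% 5).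
  have ltPj : j.-1 < n.+1 by lia.
  apply: (nbr (i, Ordinal ltPj)); first by rewrite /=; lia.
  by rewrite /cart_prod /path_rel /= eqxx; lia.
(* Only the rows 2j + 1 and 2j - 1 remain, adjacent to the diagonal vertex on the 5-cycle. *)
apply: (nbr (inord (2 * j %% 5), j)); rewrite /= ?inordK ?ltn_pmod //.
rewrite /cart_prod /cycle_rel /= eqxx inordK ?ltn_pmod //; lia.
Qed.

Lemma weight_diagonal_rdf : weight diagonal_rdf <= n.+1 * (k + 1) + 2 * k.
Proof.
pose a : 'I_5 * 'I_n.+1 := (inord 3, ord0).
pose b : 'I_5 * 'I_n.+1 := (inord (2 * n.+1 %% 5), ord_max).
have sum_at (c : 'I_5 * 'I_n.+1) : \sum_v (if v == c then k else 0) = k.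
  by rewrite -big_mkcond big_pred1_eq.
(* The bound is written as a sum over all vertices, one summand for the diagonal and one for each
   left-over vertex, so that a pointwise comparison suffices and overlaps need no separate
   treatment. *)
have -> : n.+1 * (k + 1) =
    \sum_(v : 'I_5 * 'I_n.+1) if v.1 == inord (2 * v.2 %% 5) then k + 1 else 0.
  rewrite -(pair_bigA _ (fun (i : 'I_5) (j : 'I_n.+1) =>
    if i == inord (2 * j %% 5) then k + 1 else 0)) exchange_big /=.
  under eq_bigr do rewrite -big_mkcond big_pred1_eq.
  by rewrite sum_nat_const card_ord.
have -> : 2 * k = \sum_v (if v == a then k else 0)
                + \sum_v (if v == b then k else 0).
  by rewrite !sum_at mul2n addnn.
rewrite -!big_split /=.
apply: leq_sum => v _; rewrite ffunE /left_over -/a -/b.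
case: ifP => _ /=; first by rewrite addn1 leq_addr.
by case: eqP => _; case: eqP => _ //=; rewrite inordK // ?leq_addr.
Qed.

End Construction.

Theorem theorem4 (n k : nat) (hn : 2 <= n) (hk : 1 <= k) :
  roman_domination_number (cart_prod (@cycle_rel 5) (@path_rel n)) k
    <= n * (k + 1) + 2 * k.
Proof.
case: n hn => // n _.
have [_ minR] :=
  roman_domination_number_min (cart_prod (@cycle_rel 5) (@path_rel n.+1)) k.
apply: leq_trans (weight_diagonal_rdf n k).
exact: minR (diagonal_rdf_dominating n k).
Qed.
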